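(* Let $r>s\ge1$ be integers and let $G=\overline{\langle a_1,\dots,a_r\rangle}\subset W$ be the closed subgroup topologically generated by the elements $a_1,\dots,a_r\in W$ determined by $a_1=\sigma$, $a_{s+1}=(a_s,a_r)$, and $a_i=(a_{i-1},1)$ for $i\ne1,s+1$. Let $G_{\mathrm{ab}}$ denote the maximal profinite abelian factor group of $G$. Then the homomorphism $(\operatorname{sgn}_i)_{i=1}^r|_G: G\to\{\pm1\}^r$ induces an isomorphism $G_{\mathrm{ab}}\xrightarrow{\sim}\{\pm1\}^r$.
   Context: $T$ is the infinite rooted binary tree whose vertices are the finite words over $\{0,1\}$, with root the empty word, each word $t$ being joined by an edge to $t0$ and $t1$; the level $n$ of $T$ is the set of words of length $n$. $W:=\operatorname{Aut}(T)$ is its automorphism group, a profinite group as the inverse limit of the finite groups $W_n=\operatorname{Aut}(T_n)$, where $T_n\subset T$ is the subtree of words of length $\le n$. For $u,v\in W$, $(u,v)\in W$ denotes the automorphism $0t\mapsto 0\,u(t)$, $1t\mapsto 1\,v(t)$ for all words $t$; $\sigma\in W$ is the automorphism of order $2$ with $0t\mapsto 1t$ and $1t\mapsto 0t$. Thus $W=(W\times W)\rtimes\langle\sigma\rangle$. The recursion relations for $a_1,\dots,a_r$ have a unique solution in $W$. For $w\in W$, $\operatorname{sgn}_n(w)\in\{\pm1\}$ is the sign of the permutation of the level $n$ of $T$ induced by $w$; $\operatorname{sgn}_n:W\to\{\pm1\}$ is a continuous homomorphism. *)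

(* Defs.v *)
From HB Require Import structures.
From mathcomp Require Import all_boot all_order all_algebra perm.
From mathcomp Require Import all_classical topology.

Set Implicit Arguments.
Unset Strict Implicit.
Unset Printing Implicit Defensive.

Local Open Scope classical_set_scope.
Local Open Scope group_scope.

HB.mixin Record isTopologicalGroup G & Group G & Topological G := {
  mulg_continuous : continuous (fun p : G * G => p.1 * p.2) ;
  invg_continuous : continuous (fun x : G => x^-1)
}.

#[short(type="topologicalGroupType")]
HB.structure Definition TopologicalGroup :=
  {G of Group G & Topological G & isTopologicalGroup G}.

Section ClosedGenerated.
Variable G : topologicalGroupType.

Definition subgroup : set (set G) := [set H | group_closed [in H]].

Definition topgen (A : set G) : set G := closure (smallest subgroup A).

Lemma smallest_subgroup A : subgroup (smallest subgroup A).
Proof.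
split=> [|x y]; rewrite !inE.
  by move=> H /= [[H1 _] _]; rewrite inE in H1.
move=> Hx Hy H /= HA; have [[_ HB] AH] := HA.
by have := HB x y; rewrite !inE; apply; [exact: Hx | exact: Hy].
Qed.

Lemma topgen_group_closed A : group_closed (fun x => x \in topgen A).
Proof.
have [H1 HB] := smallest_subgroup A.
split=> [|x y]; rewrite ?/(_ \in _)/= !inE.
  by apply: subset_closure; rewrite inE in H1.
move=> cx cy U; rewrite -[x / y]/((fun p : G * G => p.1 * p.2) (x, y^-1)).
move=> /mulg_continuous[[V V'] /= [Vx V'y] VU].
have [h [Hh Vh]] := cx _ Vx.
have [k [Hk Vk]] := cy _ (@invg_continuous G y _ V'y).
exists (h / k); split; last exact: (VU (h, k^-1)).
by have := HB h k; rewrite !inE; apply.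
Qed.

Definition topgen_group (A : set G) : Type := set_type (topgen A).

Section Instances.
Variable A : set G.
HB.instance Definition _ := SubChoice.on (topgen_group A).
HB.instance Definition _ := Topological.copy (topgen_group A)
  (set_type (topgen A)).
HB.instance Definition _ :=
  SubChoice_isSubGroup.Build G _ (topgen_group A) (topgen_group_closed A).

Let val_continuous : continuous (val : topgen_group A -> G).
Proof. exact: (@initial_continuous _ _ (set_val : set_type (topgen A) -> G)). Qed.

Let mul_continuous :
  continuous (fun p : topgen_group A * topgen_group A => p.1 * p.2).
Proof.
apply: (@continuous_comp_initial (set_type (topgen A)) _ _ set_val).
move=> [x y].
apply: (@continuous2_cvg _ _ _ _ _ _ (fun p : topgen_group A * _ => val p.1)
  (fun p => val p.2) (fun u v : G => u * v)).
- exact: (@mulg_continuous G (val x, val y)).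
- by apply: (cvg_comp _ val _ (@val_continuous x)); exact: cvg_fst.
- by apply: (cvg_comp _ val _ (@val_continuous y)); exact: cvg_snd.
Qed.

Let inv_continuous : continuous (fun x : topgen_group A => x^-1).
Proof.
apply: (@continuous_comp_initial (set_type (topgen A)) _ _ set_val).
move=> x; apply: (@continuous_comp _ _ _
  (val : topgen_group A -> G) (fun x : G => x^-1)).
  exact: val_continuous.
exact: invg_continuous.
Qed.

HB.instance Definition _ :=
  isTopologicalGroup.Build (topgen_group A) mul_continuous inv_continuous.
End Instances.

End ClosedGenerated.

Section Abelianization.
Variable G : topologicalGroupType.

(* The factor group G / N is abelian iff N contains all commutators; for a    *)
(* profinite group G it is profinite iff N is closed.                         *)
Definition ab_normal : set (set G) :=
  [set N | [/\ subgroup N, closed N, forall x y, N x -> N (x ^ y) &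
               forall x y, N [~ x, y]]].

(* The least such N, so that G / N is the largest factor group.               *)
Definition ab_kernel : set G := smallest ab_normal set0.

Lemma ab_normal_kernel : ab_normal ab_kernel.
Proof.
split.
- split=> [|x y]; rewrite !inE.
    by move=> N /= [[[N1 _] _ _ _] _]; rewrite inE in N1.
  move=> Kx Ky N /= NA; have [[[_ NB] _ _ _] _] := NA.
  by have := NB x y; rewrite !inE; apply; [exact: Kx | exact: Ky].
- by apply: closed_bigI => N /= [[_ cN _ _] _].
- move=> x y Kx N /= NA; have [[_ _ NJ _] _] := NA.
  by apply: NJ; exact: Kx.
- by move=> x y N /= [[_ _ _ NR] _].
Qed.

Definition ab_rel (x y : G) : bool := `[< ab_kernel (x^-1 * y) >].

Let K1 : ab_kernel 1.
Proof. by have [[+ _] _ _ _] := ab_normal_kernel; rewrite inE. Qed.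

Let KF x y : ab_kernel x -> ab_kernel y -> ab_kernel (x / y).
Proof.
by have [[_ KB] _ _ _] := ab_normal_kernel; have := KB x y; rewrite !inE.
Qed.

Let KV x : ab_kernel x -> ab_kernel x^-1.
Proof. by move=> Kx; rewrite -div1g; exact: KF. Qed.

Let KM x y : ab_kernel x -> ab_kernel y -> ab_kernel (x * y).
Proof. by move=> Kx /KV Ky; rewrite -[y]invgK; exact: KF. Qed.

Let KJ x y : ab_kernel x -> ab_kernel (x ^ y).
Proof. by have [_ _ KJ _] := ab_normal_kernel; exact: KJ. Qed.

Lemma ab_rel_refl : reflexive ab_rel.
Proof. by move=> x; apply/asboolP; rewrite mulVg. Qed.

Lemma ab_rel_sym : symmetric ab_rel.
Proof.
move=> x y; apply/asboolP/asboolP => /KV; by rewrite invgM invgK.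
Qed.

Lemma ab_rel_trans : transitive ab_rel.
Proof.
move=> y x z /asboolP Kxy /asboolP Kyz; apply/asboolP.
by have := KM Kxy Kyz; rewrite mulgA mulgK.
Qed.

Canonical ab_equiv := EquivRel ab_rel ab_rel_refl ab_rel_sym ab_rel_trans.

Definition abelianization : Type := quotient_topology {eq_quot ab_equiv}%qT.

HB.instance Definition _ := Quotient.on abelianization.
HB.instance Definition _ := Topological.on abelianization.

Definition ab_proj (x : G) : abelianization := \pi_abelianization%qT x.

Lemma ab_projP x y : ab_proj x = ab_proj y <-> ab_kernel (x^-1 * y).
Proof.
split=> [|Kxy]; first by move=> /(@eqquotP _ ab_equiv)/asboolP.
by apply/(@eqquotP _ ab_equiv)/asboolP.
Qed.

Lemma ab_projK (u : abelianization) : ab_proj (repr u) = u.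
Proof. exact: reprK. Qed.

Let repr_projV x : ab_kernel (x^-1 * repr (ab_proj x)).
Proof. by apply/ab_projP; rewrite ab_projK. Qed.

Definition ab_one : abelianization := ab_proj 1.
Definition ab_mul (u v : abelianization) : abelianization :=
  ab_proj (repr u * repr v).
Definition ab_inv (u : abelianization) : abelianization := ab_proj (repr u)^-1.

Let ab_mulE x y : ab_mul (ab_proj x) (ab_proj y) = ab_proj (x * y).
Proof.
apply/esym/ab_projP.
have := KM (KJ y (repr_projV x)) (repr_projV y).
by rewrite conjgE invgM !mulgA mulgK.
Qed.

Let ab_invE x : ab_inv (ab_proj x) = ab_proj x^-1.
Proof.
apply/esym/ab_projP; have := KJ x^-1 (KV (repr_projV x)).
by rewrite conjgE invgM !invgK !mulgA mulgK.
Qed.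

Let ab_mulA : associative ab_mul.
Proof.
move=> u v w; rewrite -[u]ab_projK -[v]ab_projK -[w]ab_projK.
by rewrite !ab_mulE mulgA.
Qed.

Let ab_mul1 : left_id ab_one ab_mul.
Proof. by move=> u; rewrite -[u]ab_projK ab_mulE mul1g. Qed.

Let ab_1mul : right_id ab_one ab_mul.
Proof. by move=> u; rewrite -[u]ab_projK ab_mulE mulg1. Qed.

Let ab_mulV : left_inverse ab_one ab_inv ab_mul.
Proof. by move=> u; rewrite -[u]ab_projK ab_invE ab_mulE mulVg. Qed.

Let ab_Vmul : right_inverse ab_one ab_inv ab_mul.
Proof. by move=> u; rewrite -[u]ab_projK ab_invE ab_mulE mulgV. Qed.

HB.instance Definition _ :=
  isGroup.Build abelianization ab_mulA ab_mul1 ab_1mul ab_mulV ab_Vmul.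

Lemma ab_projM : {morph ab_proj : x y / x * y}.
Proof. by move=> x y; rewrite -ab_mulE. Qed.

End Abelianization.

(* Words over {0,1}, with 0 = false and 1 = true; the first letter is the head *)
(* of the sequence.                                                            *)
Definition word : Type := seq bool.

Definition edge (t u : word) : bool :=
  [exists b : bool, (u == rcons t b) || (t == rcons u b)].

Definition is_aut (w : word -> word) : Prop :=
  [/\ bijective w, w [::] = [::] & forall t u, edge (w t) (w u) = edge t u].

Definition W : Type := {w : word -> word | `[< is_aut w >]}.

HB.instance Definition _ := SubChoice.on W.

Definition act (w : W) : word -> word := val w.

Definition aut_of (f : word -> word) (fP : is_aut f) : W := exist _ f (asboolT fP).

Lemma act_aut (w : W) : is_aut (act w).
Proof. exact: asboolW (valP w). Qed.

Lemma W_ext (u v : W) : act u =1 act v -> u = v.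
Proof. by move=> uv; apply/val_inj/funext. Qed.

Lemma is_aut_id : is_aut id.
Proof. by split=> //; exists id. Qed.

Lemma is_aut_comp f g : is_aut f -> is_aut g -> is_aut (f \o g).
Proof.
move=> [bf f0 fE] [bg g0 gE]; split; first exact: bij_comp.
  by rewrite /= g0.
by move=> t u; rewrite /= fE gE.
Qed.

Lemma is_aut_can f g : is_aut f -> cancel f g -> cancel g f -> is_aut g.
Proof.
move=> [bf f0 fE] fK gK; split; first by exists f.
  by rewrite -[RHS]fK f0.
by move=> t u; rewrite -fE !gK.
Qed.

Lemma act_inv_ex (w : W) : {g | cancel (act w) g /\ cancel g (act w)}.
Proof. by apply: cid; have [[g wK gK] _ _] := act_aut w; exists g. Qed.

Definition W_one : W := aut_of is_aut_id.
Definition W_mul (u v : W) : W := aut_of (is_aut_comp (act_aut u) (act_aut v)).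
Definition W_inv (w : W) : W :=
  let: exist g (conj wK gK) := act_inv_ex w in
  aut_of (is_aut_can (act_aut w) wK gK).

Lemma W_invK (w : W) : cancel (act w) (act (W_inv w)).
Proof. by rewrite /W_inv; case: act_inv_ex => g []. Qed.

Lemma W_invVK (w : W) : cancel (act (W_inv w)) (act w).
Proof. by rewrite /W_inv; case: act_inv_ex => g []. Qed.

Lemma W_mulA : associative W_mul.
Proof. by move=> u v w; apply: W_ext. Qed.

Lemma W_mul1 : left_id W_one W_mul.
Proof. by move=> u; apply: W_ext. Qed.

Lemma W_1mul : right_id W_one W_mul.
Proof. by move=> u; apply: W_ext. Qed.

Lemma W_mulV : left_inverse W_one W_inv W_mul.
Proof. by move=> u; apply: W_ext => t; exact: W_invK. Qed.

Lemma W_Vmul : right_inverse W_one W_inv W_mul.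
Proof. by move=> u; apply: W_ext => t; exact: W_invVK. Qed.

HB.instance Definition _ := isGroup.Build W W_mulA W_mul1 W_1mul W_mulV W_Vmul.

Lemma act1 t : act 1 t = t. Proof. by []. Qed.
Lemma actM u v t : act (u * v) t = act u (act v t). Proof. by []. Qed.
Lemma actK w : cancel (act w) (act w^-1). Proof. exact: W_invK. Qed.
Lemma actVK w : cancel (act w^-1) (act w). Proof. exact: W_invVK. Qed.

Lemma act_nil w : act w [::] = [::].
Proof. by have [] := act_aut w. Qed.

Lemma act_inj w : injective (act w).
Proof. exact: can_inj (actK w). Qed.

Lemma edge_rcons t b : edge t (rcons t b).
Proof. by apply/existsP; exists b; rewrite eqxx. Qed.

Lemma act_rcons w t b : exists c, act w (rcons t b) = rcons (act w t) c.
Proof.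
have [_ w0 wE] := act_aut w.
elim/last_ind: t b => [|t c IHt] b.
  have := wE [::] (rcons [::] b); rewrite edge_rcons w0 => /existsP[d].
  by case/orP => /eqP; [exists d | case: (act w _)].
have := wE (rcons t c) (rcons (rcons t c) b); rewrite edge_rcons.
move=> /existsP[d] /orP[/eqP ->|/eqP]; first by exists d.
have [c' ->] := IHt c => /rcons_inj[/act_inj tE _].
by have := congr1 size tE; rewrite !size_rcons; elim: (size t) => // k IH [].
Qed.

Lemma size_act w t : size (act w t) = size t.
Proof.
elim/last_ind: t => [|t b IHt]; first by rewrite act_nil.
by have [c ->] := act_rcons w t b; rewrite !size_rcons IHt.
Qed.

(* u and v have the same image in W_n. *)
Definition eq_upto (n : nat) (u v : W) : Prop :=
  forall t : word, (size t <= n)%N -> act u t = act v t.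

(* The topology of the inverse limit of the finite (discrete) groups W_n: the *)
(* fibres of the projections to the W_n form a basis.                         *)
Definition W_open : set (set W) :=
  [set U | forall u, U u -> exists n, forall v, eq_upto n u v -> U v].

Lemma W_openT : W_open setT.
Proof. by move=> u _; exists 0%N. Qed.

Lemma W_openI : setI_closed W_open.
Proof.
move=> U V oU oV u [/oU[m mU] /oV[n nV]]; exists (maxn m n) => v uv.
by split; [apply: mU | apply: nV] => t tn; apply: uv;
  rewrite leq_max tn ?orbT.
Qed.

Lemma W_open_bigU (I : Type) (f : I -> set W) :
  (forall i, W_open (f i)) -> W_open (\bigcup_i f i).
Proof.
move=> of_ u [i _ /of_[n nf]]; exists n => v uv; exists i => //; exact: nf.
Qed.

HB.instance Definition _ :=
  isOpenTopological.Build W W_openT W_openI W_open_bigU.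

Lemma eq_upto_open n u : open (eq_upto n u).
Proof.
by move=> v uv; exists n => w vw t tn; rewrite uv// vw.
Qed.

Lemma nbhs_WP (u : W) (U : set W) :
  nbhs u U <-> exists n, forall v, eq_upto n u v -> U v.
Proof.
split=> [[V [oV Vu VU]]|[n nU]].
  by have [n nV] := oV u Vu; exists n => v /nV /VU.
exists (eq_upto n u); split=> //; exact: eq_upto_open.
Qed.

Lemma W_mul_continuous : continuous (fun p : W * W => p.1 * p.2).
Proof.
move=> [u v] U /nbhs_WP[n nU].
exists (eq_upto n u, eq_upto n v) => /=.
  by split; apply/nbhs_WP; exists n.
move=> [u' v'] /= [uu' vv']; apply: nU => t tn.
by rewrite !actM -vv'// uu'// size_act.
Qed.

Lemma W_inv_continuous : continuous (fun u : W => u^-1).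
Proof.
move=> u U /nbhs_WP[n nU]; apply/nbhs_WP; exists n => v uv; apply: nU => t tn.
by apply: (@act_inj v); rewrite actVK -uv ?actVK// size_act.
Qed.

HB.instance Definition _ :=
  isTopologicalGroup.Build W W_mul_continuous W_inv_continuous.

Definition pair_fun (u v : word -> word) (t : word) : word :=
  match t with
  | [::] => [::]
  | false :: t' => false :: u t'
  | true :: t' => true :: v t'
  end.

Definition flip_fun (t : word) : word := if t is b :: t' then ~~ b :: t' else [::].

Lemma edge0 b t : edge [::] (b :: t) = (t == [::]).
Proof.
apply/existsP/eqP => [[c /orP[/eqP[_ ->]|/eqP]]|->] //.
by exists b; rewrite eqxx.
Qed.

Lemma edgeC t u : edge t u = edge u t.
Proof. by apply: eq_existsb => b; rewrite orbC. Qed.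

Lemma edge_cons b c t u : edge (b :: t) (c :: u) = (b == c) && edge t u.
Proof.
apply/existsP/andP => [[d /orP[/eqP[-> ->]|/eqP[-> ->]]]|[/eqP-> /existsP[d tu]]].
- by rewrite eqxx edge_rcons.
- by rewrite eqxx edgeC edge_rcons.
- by exists d; rewrite !rcons_cons !eqseq_cons eqxx.
Qed.

Lemma is_aut_pair u v : is_aut u -> is_aut v -> is_aut (pair_fun u v).
Proof.
move=> [[u' uK u'K] u0 uE] [[v' vK v'K] v0 vE].
have nilE w w' : w [::] = [::] -> cancel w w' ->
    forall t : word, (w t == [::] :> word) = (t == [::]).
  by move=> w0 wK t; rewrite -{1}w0 (inj_eq (can_inj wK)).
split=> //.
  by exists (pair_fun u' v') => -[|[] t] //=; rewrite ?uK ?vK ?u'K ?v'K.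
move=> [|[] t] [|[] t'] //=.
all: by rewrite ?(edgeC (_ :: _) [::]) ?edge0 ?edge_cons ?uE ?vE
  ?(nilE u u') ?(nilE v v').
Qed.

Lemma is_aut_flip : is_aut flip_fun.
Proof.
split=> //; first by exists flip_fun => -[|[] t].
move=> [|b t] [|c t'] //=; rewrite ?(edgeC (_ :: _) [::]) ?edge0 ?edge_cons//.
by case: b c => -[].
Qed.

Definition pairW (u v : W) : W := aut_of (is_aut_pair (act_aut u) (act_aut v)).

Definition sigma : W := aut_of is_aut_flip.

Definition sign : Type := {z : int | (z == 1%R) || (z == (-1)%R)}.

HB.instance Definition _ := SubChoice.on sign.

Lemma sign_mulP (x y : sign) :
  ((val x * val y == 1) || (val x * val y == -1))%R.
Proof. by case/orP: (valP x) => /eqP->; case/orP: (valP y) => /eqP->. Qed.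

Definition sign_one : sign := Sub 1%R isT.
Definition sign_mone : sign := Sub (-1)%R isT.
Definition sign_mul (x y : sign) : sign := Sub (val x * val y)%R (sign_mulP x y).

Lemma sign_mulA : associative sign_mul.
Proof. by move=> x y z; apply/val_inj; rewrite /= GRing.mulrA. Qed.

Lemma sign_mul1 : left_id sign_one sign_mul.
Proof. by move=> x; apply/val_inj; rewrite /= GRing.mul1r. Qed.

Lemma sign_1mul : right_id sign_one sign_mul.
Proof. by move=> x; apply/val_inj; rewrite /= GRing.mulr1. Qed.

Lemma sign_mulV : left_inverse sign_one id sign_mul.
Proof. by move=> x; apply/val_inj => /=; case/orP: (valP x) => /eqP->. Qed.

HB.instance Definition _ :=
  isGroup.Build sign sign_mulA sign_mul1 sign_1mul sign_mulV sign_mulV.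

Section Sgn.
Variables (n : nat) (w : W).

Let level_tupleP (t : n.-tuple bool) : size (act w t) == n.
Proof. by rewrite size_act size_tuple. Qed.

Definition level_act (t : n.-tuple bool) : n.-tuple bool :=
  Tuple (level_tupleP t).

Lemma level_act_inj : injective level_act.
Proof. by move=> t u [/act_inj tu]; exact: val_inj. Qed.

Definition level_perm : {perm n.-tuple bool} := perm level_act_inj.

Definition sgn : sign := if odd_perm level_perm then sign_mone else sign_one.

End Sgn.

Definition signs (r : nat) : Type := discrete_topology {ffun 'I_r -> sign}.

Section Signs.
Variable r : nat.
HB.instance Definition _ := Group.copy (signs r) {ffun 'I_r -> sign}.
HB.instance Definition _ := Topological.on (signs r).
End Signs.

(* Main.v *)
(* The generators satisfy [a_i ^ 2 = 1], so the abelianization, being          *)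
(* generated by their images, has at most [2 ^ r] elements. Conversely, from   *)
(* [sgn_(n+1) (u, v) = sgn_n u * sgn_n v] and the fact that [sigma] is odd     *)
(* only on level 1, one gets [sgn_n a_i = -1] iff [n = i], for [n <= r]: here  *)
(* the extra factor [sgn_n a_r] coming from [a_(s+1)] is trivial as [n < r].   *)
(* Thus the signs already separate [2 ^ r] classes.                            *)

Require Import Defs.
From mathcomp Require Import all_boot all_order all_algebra perm.
From mathcomp Require Import all_classical topology.

Set Implicit Arguments.
Unset Strict Implicit.
Unset Printing Implicit Defensive.

Local Open Scope classical_set_scope.
Local Open Scope group_scope.

(** By [odd_level_perm_gen] the sign vectors of the generators are the standard basis of
    $\{\pm1\}^r$, and by [gen_sqr] the generators are involutions. Adjoining an involution to a
    closed subgroup that contains all commutators adds at most one coset, so the result is again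
    closed ([ab_normal_adjoin]). Starting from [ab_kernel], $r$ such steps give a closed subgroup
    containing every generator, hence all of $G$ ([partial_span_total]). So modulo [ab_kernel] each
    element is a product of distinct generators, which its signs determine: the kernel of the signs
    is exactly [ab_kernel] ([partial_span_ker]). *)

(* Any permutation of [T] is a product of transpositions, and the transposition *)
(* of [x] and [y] extends to that of [f x] and [f y].                           *)
Lemma odd_perm_extend (T T' : finType) (f : T -> T') (s : {perm T})
    (s' : {perm T'}) :
  injective f -> (forall x, s' (f x) = f (s x)) ->
  (forall y, y \notin codom f -> s' y = y) -> odd_perm s' = odd_perm s.
Proof.
move=> finj s'f s'out; have [ts sE dts] := prod_tpermP s.
have s'E : s' = \prod_(t <- [seq (f t.1, f t.2) | t <- ts]) tperm t.1 t.2.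
  apply/permP => y; rewrite big_map /=.
  have [/codomP[x ->]|yN] := boolP (y \in codom f).
    rewrite s'f sE; elim: {dts sE} ts x => [|t ts IH] x.
      by rewrite !big_nil !perm1.
    by rewrite !big_cons !permM IH -(inj_tperm _ _ _ finj).
  rewrite s'out//; elim: {dts sE} ts => [|t ts IH].
    by rewrite big_nil perm1.
  rewrite big_cons permM tpermD//; apply: contraNneq yN => <-; exact: codom_f.
rewrite sE s'E !odd_perm_prod ?size_map// all_map.
by apply: sub_all dts => -[x y]; rewrite /= /dpair/= (inj_eq finj).
Qed.

(** * Parity of the action on a level *)

Lemma odd_level_permM n u v :
  odd_perm (level_perm n (u * v)) =
  odd_perm (level_perm n u) (+) odd_perm (level_perm n v).
Proof.
rewrite addbC -odd_permM; congr (odd_perm _); apply/permP => t.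
by rewrite permM !permE; apply: val_inj.
Qed.

Lemma odd_level_perm1 n : odd_perm (level_perm n 1) = false.
Proof.
by rewrite -(odd_perm1 (n.-tuple bool)); congr (odd_perm _); apply/permP => t;
  rewrite permE perm1; apply: val_inj.
Qed.

Lemma odd_level_perm0 u : odd_perm (level_perm 0 u) = false.
Proof.
rewrite -(odd_perm1 (0.-tuple bool)); congr (odd_perm _); apply/permP => t.
by rewrite (tuple0 (level_perm _ _ _)) (tuple0 (perm_one _ _)).
Qed.

Lemma odd_level_perm_half n b (u w : W) :
  (forall t, act w (b :: t) = b :: act u t) ->
  (forall t, act w (~~ b :: t) = ~~ b :: t) ->
  odd_perm (level_perm n.+1 w) = odd_perm (level_perm n u).
Proof.
move=> wb wNb.
apply: (@odd_perm_extend _ _ (fun t : n.-tuple bool => cons_tuple b t)).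
- by move=> t t' [tt']; apply: val_inj.
- by move=> t; rewrite !permE; apply: val_inj; rewrite /= wb.
- move=> t tN; rewrite permE; apply: val_inj => /=.
  case/tupleP: t tN => c t tN /=; have [cb|/negPf cNb] := eqVneq c b.
    by case/negP: tN; rewrite cb; apply/codomP; exists t; apply: val_inj.
  by have -> : c = ~~ b by case: c b cNb {tN wb wNb} => -[].
Qed.

Lemma odd_level_perm_pair n u v :
  odd_perm (level_perm n.+1 (pairW u v)) =
  odd_perm (level_perm n u) (+) odd_perm (level_perm n v).
Proof.
have -> : pairW u v = pairW u 1 * pairW 1 v by apply: W_ext => -[|[] t].
by rewrite odd_level_permM; congr (_ (+) _);
  [apply: (@odd_level_perm_half n false) | apply: (@odd_level_perm_half n true)].
Qed.

(** The flip swaps $0t$ and $1t$, so on level $n+1$ it is a product of $2^n$ disjoint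
    transpositions. *)
Lemma odd_level_perm_sigma n : odd_perm (level_perm n.+1 sigma) = (n == 0%N).
Proof.
pose ts := [seq (cons_tuple false t, cons_tuple true t)
           | t <- enum {: n.-tuple bool}].
have -> : level_perm n.+1 sigma = \prod_(t <- ts) tperm t.1 t.2.
  apply/permP => y; case/tupleP: y => b y; rewrite permE big_map /=.
  rewrite [level_act _ _](_ : _ = if y \in enum {: n.-tuple bool}
    then cons_tuple (~~ b) y else cons_tuple b y); last first.
    by rewrite mem_enum; apply: val_inj.
  elim: (enum _) (enum_uniq {: n.-tuple bool}) b
    => [|t s IH] /= => [_ b|/andP[tNs us] b]; first by rewrite big_nil perm1.
  rewrite big_cons permM inE; have [yt|yNt] /= := eqVneq y t.
    rewrite -yt in tNs *.
    by case: b; rewrite (tpermL, tpermR) -IH// (negPf tNs).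
  by rewrite tpermD ?IH//; apply: contra_neq yNt => -[_ ?]; apply: val_inj.
have dts : all dpair ts.
  by rewrite all_map; apply/allP => t _; apply/eqP => -[].
rewrite odd_perm_prod//.
have -> : size ts = (2 ^ n)%N by rewrite size_map -cardT card_tuple card_bool.
by rewrite oddX orbF.
Qed.

(** * The recursively defined generators *)

Section Generators.
Variables (r s : nat) (a : nat -> W).
Hypotheses (hs : (1 <= s)%N) (hsr : (s < r)%N) (ha1 : a 1%N = sigma)
  (has : a s.+1 = pairW (a s) (a r))
  (ha : forall i : nat, (1 <= i <= r)%N -> i <> 1%N -> i <> s.+1 ->
    a i = pairW (a i.-1) 1).

(** The induction is on the level: the recursion for [a s.+1] refers to the larger index [r], but
    always one level lower. *)
Lemma odd_level_perm_gen n i : (n <= r)%N -> (1 <= i <= r)%N ->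
  odd_perm (level_perm n (a i)) = (n == i).
Proof.
elim: n i => [|n IH] [|i]// nr ir; first by rewrite odd_level_perm0.
have [i0|/eqP iN0] := eqVneq i 0%N.
  by rewrite i0 ha1 odd_level_perm_sigma.
have [is1|/eqP iNs] := eqVneq i s.
  rewrite is1 has odd_level_perm_pair !IH ?hs ?(ltnW hsr) ?(ltnW nr)//.
    by rewrite (ltn_eqF nr) addbF.
  by rewrite leqnn andbT (leq_trans hs) // ltnW.
rewrite ha//; last 2 first.
- by case.
- by case.
rewrite odd_level_perm_pair odd_level_perm1 addbF IH ?(ltnW nr)//.
by rewrite lt0n (introN eqP iN0) ltnW.
Qed.

(** Since $(u,v)^2=(u^2,v^2)$, the claim passes to a shorter word, for all indices at once. *)
Lemma gen_sqr i : (1 <= i <= r)%N -> a i * a i = 1.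
Proof.
move=> ir; apply: W_ext => t; rewrite actM act1.
elim: t i ir => [|b t IH] i ir; first by rewrite !act_nil.
have [->|/eqP iN1] := eqVneq i 1%N; first by rewrite ha1; case: b.
have [is1|/eqP iNs] := eqVneq i s.+1.
  rewrite is1 has; case: b => /=; congr (_ :: _); apply: IH.
    by rewrite leqnn andbT (leq_trans hs) // ltnW.
  by rewrite hs ltnW.
rewrite ha//; case: b => //=; congr (_ :: _); apply: IH.
by case: i ir iN1 {iNs} => [|[]]// i /andP[_ /ltnW ->].
Qed.

End Generators.

(** * Induction on a topologically generated group *)

Section Topgen.
Variable G : topologicalGroupType.

Lemma topgen_ind (A : set G) (S : set (topgen_group A)) :
  subgroup S -> closed S -> (forall g, A (val g) -> S g) -> forall g, S g.
Proof.
move=> [S1 SB] cS AS g.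
have [C oC CE] : wopen (val : topgen_group A -> G) (~` S).
  exact: (closed_openC cS).
apply: contrapT => gS.
have Cg : C (val g) by have : (~` S) g by []; rewrite -CE.
pose H := [set x | exists2 h : topgen_group A, val h = x & S h].
have HG : subgroup H.
  split=> [|x y]; rewrite !inE.
    by exists 1; [exact: gmulf1 | rewrite inE in S1].
  move=> [h <- Sh] [k <- Sk]; exists (h / k); first exact: gmulfF.
  by have := SB h k; rewrite !inE; apply.
have AH : A `<=` H.
  move=> x Ax; have xA : x \in topgen A.
    by rewrite inE; apply: subset_closure; exact: sub_gen_smallest.
  by exists (exist _ x xA) => //; exact: AS.
(* As [val g] lies in the closure, its neighbourhood [C] meets the abstract subgroup generated by
   [A], which is contained in [H]. *)
have [x [Ax Cx]] := set_valP g _ (open_nbhs_nbhs (conj oC Cg)).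
have [h hx Sh] := smallest_sub HG AH Ax.
have : (~` S) h by rewrite -CE /preimage /= hx.
exact.
Qed.

End Topgen.

Lemma sign_mulgC (x y : sign) : x * y = y * x.
Proof. by apply: val_inj; exact: GRing.mulrC. Qed.

Lemma signs_mulgC r (x y : signs r) : x * y = y * x.
Proof. by apply/ffunP => i; rewrite !ffunE; exact: sign_mulgC. Qed.

(** * Closed subgroups containing all commutators *)

Section AbNormal.
Variable G : topologicalGroupType.
Implicit Type N : set G.

Lemma subgroup_mulg N x y : subgroup N -> N x -> N y -> N (x * y).
Proof.
by move=> NG Nx Ny; have := @group_closedM _ _ NG x y; rewrite !inE; apply.
Qed.

Lemma subgroup_invg N x : subgroup N -> N x -> N x^-1.
Proof.
by move=> NG Nx; have := @group_closedV _ _ NG x; rewrite !inE; apply.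
Qed.

Lemma ab_normal_mulgC N x y : ab_normal N -> N (x * y) -> N (y * x).
Proof.
by move=> [_ _ NJ _] Nxy; have := NJ _ x Nxy; rewrite conjgE -!mulgA mulKg.
Qed.

(** As $x^{-1}=x$, the set adjoined is the coset $xN$, closed as a preimage of $N$ under
    translation; $G/N$ being abelian, $N\cup xN$ is a subgroup. *)
Lemma ab_normal_adjoin N x : ab_normal N -> x * x = 1 ->
  ab_normal (N `|` [set g | N (x * g)]).
Proof.
move=> Nab x2; have [NG cN NJ NR] := Nab.
have xV : x^-1 = x by apply/divg1_eq; rewrite -invgM x2 invg1.
have [N1 NB] : N 1 /\ forall u v, N u -> N v -> N (u / v).
  by case: NG => + NB; rewrite inE; split=> // u v; have := NB u v; rewrite !inE.
have MG : subgroup (N `|` [set g | N (x * g)]).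
  split=> [|u v]; rewrite !inE; first by left.
  move=> [Nu|/= Nu] [Nv|/= Nv]; [left|right|right|left].
  - exact: NB.
  - have Nvx : N (v^-1 * x) by rewrite -xV -invgM; apply: subgroup_invg.
    rewrite /= mulgA; apply: ab_normal_mulgC => //.
    by rewrite mulgA; exact: subgroup_mulg.
  - by rewrite /= mulgA; exact: NB.
  - have := NJ _ x (NB _ _ Nu Nv).
    by rewrite conjgE invgM !mulgA mulVg mul1g mulgVK.
split=> //.
- apply: closedU => //; apply: (@preimage_closed _ _ (fun g : G => x * g)) => //.
  move=> g _; apply: (@continuous2_cvg _ _ _ _ _ _ (fun=> x) id
    (fun u v : G => u * v)).
  + exact: (@mulg_continuous G (x, g)).
  + exact: cvg_cst.
  + exact: cvg_id.
(* Normality follows from $u^y=u[u,y]$. *)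
- move=> u y Mu; rewrite -[u ^ y](mulVKg u) -commgEl.
  by apply: subgroup_mulg => //; left.
- by move=> u v; left.
Qed.

End AbNormal.

(** * Abelianization of a group generated by involutions with independent signs *)

Section AbelianizationSigns.
Variables (G : topologicalGroupType) (r : nat) (phi : G -> signs r).
Variable x : nat -> G.
Hypothesis phiM : {morph phi : g h / g * h}.
Hypothesis phi_cont : continuous phi.
Hypothesis x_sqr : forall i, (i < r)%N -> x i * x i = 1.
Hypothesis phi_x : forall i (j : 'I_r), (i < r)%N ->
  phi (x i) j = if j == i :> nat then sign_mone else sign_one.
Hypothesis x_gen : forall S : set G, subgroup S -> closed S ->
  (forall i, (i < r)%N -> S (x i)) -> forall g, S g.

Let phi1 : phi 1 = 1.
Proof. by apply: (@mulgI _ (phi 1)); rewrite -phiM !mulg1. Qed.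

Let phiV g : phi g^-1 = (phi g)^-1.
Proof. by apply: (@mulgI _ (phi g)); rewrite -phiM !mulgV phi1. Qed.

Lemma ab_normal_ker_signs : ab_normal [set g | phi g = 1].
Proof.
split=> [||g h /= g1|g h] /=.
- by split=> [|g h]; rewrite !inE //= phiM phiV => -> ->; rewrite divgg.
- apply: (@preimage_closed _ _ phi [set 1]) => [g _|]; first exact: phi_cont.
  exact: discrete_closed.
- by rewrite conjgE !phiM phiV g1 mul1g mulVg.
- by rewrite commgEl conjgE !phiM !phiV (signs_mulgC (phi g)) mulKg mulVg.
Qed.

(* As [x i] squares to 1 and commutes with everything modulo [ab_kernel], this *)
(* is the subgroup generated by [ab_kernel] and the [x i] with [i < k].        *)
Fixpoint partial_span (k : nat) : set G :=
  if k is k'.+1 then partial_span k' `|` [set g | partial_span k' (x k' * g)]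
  else @ab_kernel G.

Lemma ab_normal_partial_span k : (k <= r)%N -> ab_normal (partial_span k).
Proof.
elim: k => [|k IH] kr; first exact: ab_normal_kernel.
by apply: ab_normal_adjoin; [exact: IH (ltnW kr) | exact: x_sqr].
Qed.

Lemma ab_kernel_sub_partial_span k : @ab_kernel G `<=` partial_span k.
Proof. by elim: k => // k IH g /IH; left. Qed.

Lemma partial_span_gen k i : (i < k)%N -> (k <= r)%N -> partial_span k (x i).
Proof.
elim: k => // k IH; rewrite ltnS leq_eqVlt => /predU1P[->|ik] kr.
  right; rewrite /= x_sqr//; apply: ab_kernel_sub_partial_span.
  by have [[+ _] _ _ _] := @ab_normal_kernel G; rewrite inE.
by left; apply: IH => //; exact: ltnW.
Qed.

Lemma partial_span_total g : partial_span r g.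
Proof.
have [rG cr _ _] := ab_normal_partial_span (leqnn r).
by apply: x_gen g => // i ir; exact: partial_span_gen.
Qed.

Lemma phi_ab_kernel g : ab_kernel g -> phi g = 1.
Proof. exact: (smallest_sub ab_normal_ker_signs (@sub0set _ _)). Qed.

Lemma phi_partial_span k g (i : 'I_r) : (k <= i)%N -> partial_span k g ->
  phi g i = sign_one.
Proof.
elim: k g => [|k IH] g ki /=; first by move=> /phi_ab_kernel ->; rewrite ffunE.
move=> [|/=]; first exact: (IH _ (ltnW ki)).
move=> /(IH _ (ltnW ki)); rewrite phiM ffunE phi_x ?(ltn_trans ki)//.
by rewrite (gtn_eqF ki) => /= <-; rewrite (mul1g (phi g i)).
Qed.

Lemma partial_span_ker k g : (k <= r)%N -> partial_span k g -> phi g = 1 ->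
  ab_kernel g.
Proof.
elim: k => [//|k IH] kr /= [/(IH (ltnW kr))//|/=].
(* If [x k * g] lies in the lower span, its sign at [k] is $1$; but [phi g = 1] makes it that of
   [x k], which is $-1$. *)
move=> /(phi_partial_span (i := Ordinal kr) (leqnn k)) + g1.
by rewrite phiM g1 mulg1 phi_x//= eqxx => /(congr1 val).
Qed.

(** Multiplying by [phi (x k)] clears coordinate [k], so the support of the sign vector shrinks. *)
Lemma phi_surj e : exists g, phi g = e.
Proof.
suff: forall k, (k <= r)%N -> forall e : signs r,
    (forall i : 'I_r, (k <= i)%N -> e i = sign_one) -> exists g, phi g = e.
  by move=> /(_ r (leqnn r)); apply=> i; rewrite leqNgt ltn_ord.
elim=> [|k IH] kr {}e eE.
  by exists 1; rewrite phi1; apply/ffunP => i; rewrite ffunE eE.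
have [ek|ek] := eqVneq (e (Ordinal kr)) sign_one.
  apply: (IH (ltnW kr)) => i; rewrite leq_eqVlt => /predU1P[ki|/eE//].
  by rewrite -ek; congr (e _); exact: val_inj.
have [|g ge] := IH (ltnW kr) (phi (x k) * e).
  move=> i; rewrite ffunE phi_x// leq_eqVlt => /predU1P[ki|ki].
    have -> : i = Ordinal kr by exact: val_inj.
    rewrite /= eqxx; apply/val_inj.
    by case: (e _) ek => z /= /[dup] /orP[] /eqP ->.
  by rewrite (gtn_eqF ki) eE// (mul1g sign_one).
by exists (x k * g); rewrite phiM ge mulgA -phiM x_sqr// phi1 mul1g.
Qed.

Lemma abelianization_signs :
  exists f : abelianization G -> signs r,
    [/\ forall g : G, f (ab_proj g) = phi g,
        {morph f : u v / u * v},
        bijective f,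
        continuous f &
        forall U : set (abelianization G), open U -> open (f @` U)].
Proof.
have phiK g h : phi g = phi h <-> ab_proj g = ab_proj h.
  rewrite ab_projP; split=> [gh|/phi_ab_kernel].
    apply: (partial_span_ker (leqnn r)) (partial_span_total _) _.
    by rewrite phiM phiV gh mulVg.
  by rewrite phiM phiV => gh; apply: (@mulgI _ (phi g)^-1); rewrite gh mulVg.
pose f (u : abelianization G) : signs r := phi (repr u).
have fE g : f (ab_proj g) = phi g by apply/phiK; rewrite ab_projK.
have [s sK] := choice phi_surj.
exists f; split=> //.
- by move=> u v; rewrite -[u]ab_projK -[v]ab_projK -ab_projM !fE phiM.
- exists (fun e => ab_proj (s e)) => [u|e]; last by rewrite fE sK.
  by rewrite -[RHS]ab_projK; apply/phiK; rewrite sK.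
(* [phi] is constant on the classes, so its continuity descends to the quotient topology. *)
- apply: repr_comp_continuous => //.
  by move=> g h /eqP gh; apply/eqP/phiK.
- by move=> U _; exact: discrete_open.
Qed.

End AbelianizationSigns.

(** * The sign homomorphisms and the conclusion *)

Lemma sgnE n w :
  sgn n w = if odd_perm (level_perm n w) then sign_mone else sign_one.
Proof. by []. Qed.

Lemma sgnM n u v : sgn n (u * v) = sgn n u * sgn n v.
Proof.
rewrite !sgnE odd_level_permM.
by apply: val_inj; case: (odd_perm _) (odd_perm _) => -[].
Qed.

Lemma sgn_eq_upto n u v : eq_upto n u v -> sgn n u = sgn n v.
Proof.
move=> uv; rewrite !sgnE; congr (if odd_perm _ then _ else _).
apply/permP => t; rewrite !permE; apply: val_inj.
by rewrite /= uv// size_tuple.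
Qed.

Lemma sgns_continuous (A : set W) r :
  continuous (fun g : topgen_group A =>
    [ffun i : 'I_r => sgn i.+1 (val g)] : signs r).
Proof.
apply/continuousP => U _.
pose sgns w : signs r := [ffun i : 'I_r => sgn i.+1 w].
(* The first [r] signs depend only on the action on words of length at most [r], so this preimage is
   open in [W]. *)
exists (sgns @^-1` U) => //; move=> u Uu; exists r => v uv.
rewrite /preimage/= (_ : sgns v = sgns u)//; apply/ffunP => i; rewrite !ffunE.
by apply/esym/sgn_eq_upto => t ti; apply: uv; exact: leq_trans ti (ltn_ord i).
Qed.

Theorem theorem3p1p6 (r s : nat) (a : nat -> W)
    (hs : (1 <= s)%N) (hsr : (s < r)%N)
    (ha1 : a 1%N = sigma)
    (has : a s.+1 = pairW (a s) (a r))
    (ha : forall i : nat, (1 <= i <= r)%N -> i <> 1%N -> i <> s.+1 ->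
      a i = pairW (a i.-1) 1) :
  let G := topgen_group [set a i | i in [set i | (1 <= i <= r)%N]] in
  exists f : abelianization G -> signs r,
    [/\ forall g : G, f (ab_proj g) = [ffun i : 'I_r => sgn i.+1 (val g)],
        {morph f : x y / x * y},
        bijective f,
        continuous f &
        forall U : set (abelianization G), open U -> open (f @` U)].
Proof.
move=> G.
have aG i : (i < r)%N ->
    a i.+1 \in topgen [set a i | i in [set i | (1 <= i <= r)%N]].
  move=> ir; rewrite inE; apply: subset_closure; apply: sub_gen_smallest.
  by exists i.+1.
(* Indices shift by one to match ['I_r]; the default [1] is never reached for [i < r]. *)
pose x i : G := if insub (a i.+1) is Some g then g else 1.
have xE i : (i < r)%N -> val (x i) = a i.+1.
  by move=> ir; rewrite /x insubT ?aG.
apply: (@abelianization_signs G r _ x).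
- move=> g h; apply/ffunP => i; rewrite !ffunE valM; exact: sgnM.
- exact: sgns_continuous.
- move=> i ir; apply: val_inj; rewrite valM xE// (gen_sqr hs hsr ha1 has ha)//.
- move=> i j ir; rewrite ffunE xE// sgnE.
  by rewrite (odd_level_perm_gen hs hsr ha1 has ha).
- move=> S SG cS xS; apply: topgen_ind => // g [[|i] /= ir ig]//.
  by have -> : g = x i :> G by [apply: val_inj; rewrite xE]; exact: xS.
Qed.
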